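(* $$\lim_{k\to\infty}\sigma(k\text{-Set Cover}/(n+t))\le\sigma(\text{Steiner Tree}/t),\quad\text{and}\quad\lim_{k\to\infty}\sigma(k\text{-}\oplus\text{Set Cover}/(n+t))\le\sigma(\oplus_t\text{Steiner Tree}/t).$$
   Context: $k$-Set Cover: given an integer $t$ and $\mathcal F\subseteq 2^U$, $|U|=n$, sets of size at most $k$, decide whether some $\mathcal C\subseteq\mathcal F$ with $|\mathcal C|\le t$ covers $U$. $k$-$\oplus$Set Cover: same input; decide whether the number of $\mathcal C\subseteq\mathcal F$ with $|\mathcal C|=t$ and $\bigcup_{S\in\mathcal C}S=U$ is odd. Steiner Tree: given an integer $t$ and a graph $G=(V,E)$ with terminals $T\subseteq V$, decide whether there is $X$ with $T\subseteq X\subseteq V$, $|X|\le t$, $G[X]$ connected. $\oplus_t$Steiner Tree: same input; decide whether the number of such $X$ with $|X|=t$ is odd. For a problem $\Pi$ with input size $m$ and a numerical parameter $p$ of the instance, $\sigma(\Pi/p)$ is the infimum of all $\epsilon>0$ such that $\Pi$ has a randomized algorithm with error probability at most $1/3$ running in time $2^{\epsilon p}\mathrm{poly}(m)$. *)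

(* Defs.v *)
From HB Require Import structures.
From mathcomp Require Import all_boot all_order all_algebra.
From mathcomp Require Import all_classical all_reals all_analysis.

Set Implicit Arguments.
Unset Strict Implicit.
Unset Printing Implicit Defensive.

Import Order.TTheory GRing.Theory Num.Theory.

(** A program is a randomized random-access machine in structured form.  It
    acts on finitely many registers (mentioned by fixed indices) and on an
    unbounded memory that is addressed through the contents of registers.  Both
    hold natural numbers of arbitrary size, and time is measured by the
    logarithmic cost criterion: an instruction is charged the bit lengths of the
    numbers and addresses that it manipulates.  Unit cost on words of O(log T)
    bits, T being the running time, differs from this by a factor O(log T) only,
    which does not affect the exponents [sigma] below. *)

Definition bitlen (x : nat) : nat := (trunc_log 2 x).+1.

Inductive arith : Type := Add | Sub | Mul | Div.

Definition arith_val (o : arith) : nat -> nat -> nat :=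
  match o with Add => addn | Sub => subn | Mul => muln | Div => divn end.

Inductive cmd : Type :=
| Skip
| Const (r v : nat)
| Arith (o : arith) (r a b : nat)
| Read (r a : nat)
| Write (a b : nat)
| Flip (r : nat)
| Seq (c d : cmd)
| If (r : nat) (c d : cmd)
| While (r : nat) (c : cmd).

(* [coins] are the random bits that have not been used yet. *)
Record state : Type := State {
  reg : nat -> nat;
  memory : nat -> nat;
  coins : seq bool
}.

(* [exec c s s' k]: started in [s], the program [c] halts in [s'] at cost [k].
   A [Flip] on an empty list of coins is stuck. *)
Inductive exec : cmd -> state -> state -> nat -> Prop :=
| ExecSkip s :
    exec Skip s s 1
| ExecConst r v g h w :
    exec (Const r v) (State g h w) (State [eta g with r |-> v] h w) (bitlen v)
| ExecArith o r a b g h w :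
    exec (Arith o r a b) (State g h w)
      (State [eta g with r |-> arith_val o (g a) (g b)] h w)
      (bitlen (g a) + bitlen (g b))
| ExecRead r a g h w :
    exec (Read r a) (State g h w) (State [eta g with r |-> h (g a)] h w)
      (bitlen (g a) + bitlen (h (g a)))
| ExecWrite a b g h w :
    exec (Write a b) (State g h w) (State g [eta h with g a |-> g b] w)
      (bitlen (g a) + bitlen (g b))
| ExecFlip r g h x w :
    exec (Flip r) (State g h (x :: w)) (State [eta g with r |-> nat_of_bool x] h w) 1
| ExecSeq c d s1 s2 s3 k l :
    exec c s1 s2 k -> exec d s2 s3 l -> exec (Seq c d) s1 s3 (k + l)
| ExecIfTrue r c d s s' k :
    reg s r != 0 -> exec c s s' k -> exec (If r c d) s s' (bitlen (reg s r) + k)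
| ExecIfFalse r c d s s' k :
    reg s r = 0 -> exec d s s' k -> exec (If r c d) s s' (bitlen (reg s r) + k)
| ExecWhileStop r c s :
    reg s r = 0 -> exec (While r c) s s (bitlen (reg s r))
| ExecWhileStep r c s1 s2 s3 k l :
    reg s1 r != 0 -> exec c s1 s2 k -> exec (While r c) s2 s3 l ->
    exec (While r c) s1 s3 (bitlen (reg s1 r) + k + l).

(* The input words fill the memory from address 0 on; everything else is 0. *)
Definition init (x : seq nat) (w : seq bool) : state :=
  State (fun=> 0) (nth 0 x) w.

(* With input [x] and coins [w], the program halts within cost [T] and answers
   [b]; the answer is "yes" when register 0 is nonzero. *)
Definition answers (c : cmd) (x : seq nat) (w : seq bool) (T : nat) (b : bool)
    : Prop :=
  exists s k, [/\ exec c (init x w) s k, k <= T & (reg s 0 != 0) = b].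

(* On input [x] the program always halts within cost [T], and its answer differs
   from [b] with probability at most 1/3.  A run of cost at most [T] flips at
   most [T] coins, so the sample space is that of [T] fair coins. *)
Definition decides_within (R : realType) (c : cmd) (x : seq nat) (T : nat)
    (b : bool) : Prop :=
  exists out : T.-tuple bool -> bool,
    (forall w : T.-tuple bool, answers c x w T (out w)) /\
    (#|[set w : T.-tuple bool | out w != b]%SET|%:R
       / #|{: T.-tuple bool}|%:R <= 3%:R^-1 :> R)%R.

Record problem : Type := Problem {
  instance :> Type;
  encode : instance -> seq nat;
  yes : instance -> bool
}.

Definition input_size (P : problem) (I : P) : nat :=
  \sum_(x <- encode I) bitlen x.

(* [P] has a randomized algorithm of error probability at most 1/3 running in
   time 2^(eps * p) * poly(m), [m] being the input size. *)
Definition solvable_with_exponent (R : realType) (P : problem) (p : P -> nat)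
    (eps : R) : Prop :=
  exists (c : cmd) (q : {poly nat}), forall I : P, exists T : nat,
    (T%:R <= 2%:R `^ (eps * (p I)%:R) * (q.[input_size I])%:R :> R)%R /\
    decides_within R c (encode I) T (yes I).

(* The infimum is taken in the extended reals: it is +oo if there is no such
   exponent. *)
Definition sigma (R : realType) (P : problem) (p : P -> nat) : \bar R :=
  ereal_inf [set eps%:E | eps in
    [set eps : R | (0 < eps)%R /\ solvable_with_exponent p eps]]%classic.

Arguments sigma : clear implicits.

Definition char_vector (n : nat) (A : {set 'I_n}) : seq nat :=
  [seq nat_of_bool (i \in A) | i <- enum 'I_n].

(* The universe is ['I_sc_n]; the family is given by a list without
   repetitions. *)
Record set_cover_instance (k : nat) : Type := SetCoverInstance {
  sc_n : nat;
  sc_list : seq {set 'I_sc_n};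
  sc_t : nat;
  sc_uniq : uniq sc_list;
  sc_size : forall A : {set 'I_sc_n}, A \in sc_list -> #|A| <= k
}.

Definition sc_family (k : nat) (I : set_cover_instance k)
    : {set {set 'I_(sc_n I)}} :=
  [set A in sc_list I]%SET.

(* The universe is listed in front of the family, so that the input size is at
   least |U| even if the family is empty; t contributes its bit length. *)
Definition sc_encode (k : nat) (I : set_cover_instance k) : seq nat :=
  [:: sc_n I; size (sc_list I); sc_t I]
    ++ char_vector [set: 'I_(sc_n I)]%SET
    ++ flatten [seq char_vector A | A <- sc_list I].

Definition covers (k : nat) (I : set_cover_instance k)
    (C : {set {set 'I_(sc_n I)}}) : bool :=
  (C \subset sc_family I) && (\bigcup_(A in C) A == [set: 'I_(sc_n I)])%SET.

Arguments covers [k] I C.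

Definition set_cover (k : nat) : problem :=
  @Problem (set_cover_instance k) (@sc_encode k)
    (fun I => [exists C, covers I C && (#|C| <= sc_t I)]).

Definition parity_set_cover (k : nat) : problem :=
  @Problem (set_cover_instance k) (@sc_encode k)
    (fun I => odd #|[set C | covers I C && (#|C| == sc_t I)]%SET|).

Definition sc_param (k : nat) (I : set_cover_instance k) : nat :=
  sc_n I + sc_t I.

Record steiner_instance : Type := SteinerInstance {
  st_v : nat;
  st_adj : rel 'I_st_v;
  st_sym : symmetric st_adj;
  st_irr : irreflexive st_adj;
  st_term : {set 'I_st_v};
  st_t : nat
}.

(* Header, characteristic vector of the terminals, adjacency matrix by rows. *)
Definition st_encode (I : steiner_instance) : seq nat :=
  [:: st_v I; st_t I] ++ char_vector (st_term I)
    ++ flatten [seq char_vector [set y | st_adj x y]%SET | x <- enum 'I_(st_v I)].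

(* Any two vertices of [X] are joined by a path inside [X]. *)
Definition induces_connected (I : steiner_instance) (X : {set 'I_(st_v I)})
    : bool :=
  [forall x in X, forall y in X,
    connect (fun a b => [&& a \in X, b \in X & st_adj a b]) x y].

Definition steiner_solution (I : steiner_instance) (X : {set 'I_(st_v I)})
    : bool :=
  (st_term I \subset X) && induces_connected X.

Arguments steiner_solution I X : clear implicits.

Definition steiner_tree : problem :=
  @Problem steiner_instance st_encode
    (fun I => [exists X, steiner_solution I X && (#|X| <= st_t I)]).

Definition parity_steiner_tree : problem :=
  @Problem steiner_instance st_encode
    (fun I => odd #|[set X | steiner_solution I X && (#|X| == st_t I)]%SET|).

(* Main.v *)
(** A set cover instance with universe U, family F and bound t becomes the
    incidence graph of U and F, plus one vertex u adjacent to all sets of F, with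
    terminals U + u and bound n + t + 1.  A set of vertices containing the
    terminals, U + u + C, is connected exactly when C covers U, so solutions
    correspond bijectively, and n + t grows by 1 only.  A machine computes the
    graph in polynomial time, in place, from the last cell to the first, and
    resets its registers: the Steiner tree algorithm can then be run as if it had
    been started on the graph.  Hence every exponent for Steiner tree is one for
    k-set cover, for every k. *)

Require Import Defs.
From mathcomp Require Import all_boot all_order all_algebra.
From mathcomp Require Import all_classical all_reals all_analysis.
From mathcomp Require Import zify ring.

Set Implicit Arguments.
Unset Strict Implicit.
Unset Printing Implicit Defensive.

Import Order.TTheory GRing.Theory Num.Theory.

(** * Running times *)

Lemma lt_exp_bitlen x : x < 2 ^ bitlen x.
Proof. exact: trunc_log_ltn. Qed.

Lemma bitlen_le x l : 0 < l -> x < 2 ^ l -> bitlen x <= l.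
Proof.
case: x => [|x] l0 xl; first by rewrite /bitlen trunc_log0.
by rewrite -(ltn_exp2l _ _ (isT : 1 < 2)) (leq_ltn_trans _ xl) ?trunc_logP.
Qed.

Lemma leq_bitlen x y : x <= y -> bitlen x <= bitlen y.
Proof. by move=> xy; rewrite ltnS leq_trunc_log. Qed.

Lemma bitlen_leS x : bitlen x <= x.+1.
Proof. by apply: bitlen_le => //; apply: ltn_trans (ltn_expl _ _). Qed.

Lemma bitlen_arith o x y : bitlen (arith_val o x y) <= bitlen x + bitlen y.
Proof.
have [xl yl] := (lt_exp_bitlen x, lt_exp_bitlen y).
case: o => /=.
- apply: bitlen_le => //; rewrite expnD.
  (* Both powers are at least 2, so their sum is at most their product. *)
  have : 2 <= 2 ^ bitlen x by rewrite -{1}(expn1 2) leq_exp2l.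
  have : 2 <= 2 ^ bitlen y by rewrite -{1}(expn1 2) leq_exp2l.
  nia.
- by apply: leq_trans (leq_addr _ _); apply: leq_bitlen; rewrite leq_subr.
- by apply: bitlen_le => //; rewrite expnD ltn_mul.
- by apply: leq_trans (leq_addr _ _); apply: leq_bitlen; rewrite leq_div.
Qed.

(** The successor pays for the default entry 0, which still has bit length 1 when [s] is empty. *)
Lemma bitlen_nth s i : bitlen (nth 0 s i) <= (\sum_(x <- s) bitlen x).+1.
Proof.
have [si|/(mem_nth 0) si] := leqP (size s) i.
  by rewrite nth_default // /bitlen trunc_log0.
by rewrite (big_rem _ si) /= -addnS leq_addr.
Qed.

Lemma size_le_sum_bitlen s : size s <= \sum_(x <- s) bitlen x.
Proof.
by elim: s => [|x s IH]; rewrite ?big_nil // big_cons /= -add1n leq_add.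
Qed.

(** * Straight programs and countdown loops *)

Fixpoint straight (c : cmd) : bool :=
  match c with
  | Flip _ | While _ _ => false
  | Seq c d | If _ c d => straight c && straight d
  | _ => true
  end.

(** Straight programs are deterministic and halt, so their effect is a function. The last branch is
    correct for [Skip] and a dummy value for [Flip] and [While]. *)
Fixpoint run (c : cmd) (s : state) : state :=
  match c with
  | Const r v => State [eta reg s with r |-> v] (memory s) (coins s)
  | Arith o r a b =>
      State [eta reg s with r |-> arith_val o (reg s a) (reg s b)]
        (memory s) (coins s)
  | Read r a =>
      State [eta reg s with r |-> memory s (reg s a)] (memory s) (coins s)
  | Write a b =>
      State (reg s) [eta memory s with reg s a |-> reg s b] (coins s)
  | Seq c d => run d (run c s)
  | If r c d => if reg s r != 0 then run c s else run d s
  | _ => s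
  end.

Definition bounded (l : nat) (s : state) : Prop :=
  (forall i, bitlen (reg s i) <= l) /\ (forall i, bitlen (memory s i) <= l).

Lemma boundedW l l' s : l <= l' -> bounded l s -> bounded l' s.
Proof. by move=> ll [gl hl]; split=> i; apply: leq_trans ll. Qed.

Lemma bounded_reg l s r x : bounded l s -> bitlen x <= l ->
  bounded l (State [eta reg s with r |-> x] (memory s) (coins s)).
Proof. by move=> [gl hl] xl; split=> i //=; case: eqP. Qed.

(* An instruction at most doubles the bit lengths in play, so a straight
   program, having constantly many of them, multiplies them by a constant. *)
Lemma exec_straight c : straight c -> exists D, forall l s, bounded l s ->
  exists k, [/\ exec c s (run c s) k, k <= D * l & bounded (D * l) (run c s)].
Proof.
have pos l s : bounded l s -> 0 < l by move=> [/(_ 0) + _]; case: l.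
elim: c => [|r v|o r a b|r a|a b|r|c IHc d IHd|r c IHc d IHd|r c IHc] //=.
- move=> _; exists 1 => l s sl; exists 1; rewrite mul1n.
  by split=> //; [constructor|apply: pos sl].
- move=> _; exists (bitlen v) => l s sl; exists (bitlen v).
  have l0 := pos _ _ sl.
  have vl : bitlen v <= bitlen v * l by rewrite leq_pmulr.
  split=> //; first by case: s {sl} => *; constructor.
  by apply: bounded_reg => //; apply: boundedW sl; rewrite leq_pmull.
- move=> _; exists 2 => l s sl; exists (bitlen (reg s a) + bitlen (reg s b)).
  have rl : bitlen (reg s a) + bitlen (reg s b) <= 2 * l.
    by rewrite mul2n -addnn leq_add //; apply: (proj1 sl).
  split=> //; first by case: s {sl rl} => *; constructor.
  apply: bounded_reg (leq_trans (bitlen_arith _ _ _) rl).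
  by apply: boundedW sl; rewrite leq_pmull.
- move=> _; exists 2 => l s sl.
  exists (bitlen (reg s a) + bitlen (memory s (reg s a))).
  split; first by case: s {sl} => *; constructor.
    by rewrite mul2n -addnn leq_add //; [apply: (proj1 sl)|apply: (proj2 sl)].
  apply: (@boundedW l); first by rewrite leq_pmull.
  by apply: bounded_reg => //; apply: (proj2 sl).
- move=> _; exists 2 => l s sl; exists (bitlen (reg s a) + bitlen (reg s b)).
  split; first by case: s {sl} => *; constructor.
    by rewrite mul2n -addnn leq_add //; apply: (proj1 sl).
  apply: (@boundedW l); first by rewrite leq_pmull.
  by case: sl => gl hl; split=> i //=; case: eqP.
(* The second program starts from numbers of bit length up to [D * l], whence the product
   [E * D]. *)
- case/andP=> /IHc[D HD] /IHd[E HE]; exists (D + E * D) => l s sl.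
  have [k [ck kl /HE[k' [dk kl' bl]]]] := HD _ _ sl.
  exists (k + k'); split; first exact: ExecSeq ck dk.
    by rewrite mulnDl leq_add // -mulnA.
  by apply: boundedW bl; rewrite mulnDl -mulnA leq_addl.
case/andP=> /IHc[D HD] /IHd[E HE]; exists (1 + D + E) => l s sl.
rewrite !mulnDl mul1n; have rl : bitlen (reg s r) <= l by apply: (proj1 sl).
have [rs|rs] := eqVneq (reg s r) 0.
  have [k [dk kl bl]] := HE _ _ sl.
  exists (bitlen (reg s r) + k); split; first exact: ExecIfFalse.
    by apply: leq_add => //; apply: leq_trans rl (leq_addr _ _).
  by apply: boundedW bl; rewrite leq_addl.
have [k [ck kl bl]] := HD _ _ sl.
exists (bitlen (reg s r) + k); split; first exact: ExecIfTrue.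
  by rewrite -addnA leq_add // (leq_trans kl) ?leq_addr.
by apply: boundedW bl; rewrite -addnA addnCA leq_addr.
Qed.

(** [S b] is the state in which the counter [r] is [b]. A round costs at most [K] for the test and
    [K] for the body; the extra round is the final test. *)
Lemma exec_countdown (S : nat -> state) r c K B :
  (forall b, b <= B -> reg (S b) r = b) ->
  (forall b, b <= B -> bitlen b <= K) ->
  (forall b, b < B -> exists2 k, exec c (S b.+1) (S b) k & k <= K) ->
  exists2 k, exec (While r c) (S B) (S 0) k & k <= B.+1 * (K + K).
Proof.
elim: B => [|B IH] regS bK cK.
  exists (bitlen (reg (S 0) r)); first by apply: ExecWhileStop; rewrite regS.
  by rewrite regS // mul1n (leq_trans (bK 0 _)) ?leq_addr.
have [||b bB|k wk kK] := IH.
- by move=> b bB; apply/regS/ltnW.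
- by move=> b bB; apply/bK/ltnW.
- by apply: cK; apply: ltnW.
have [k' ck' kK'] := cK B (ltnSn _).
exists (bitlen (reg (S B.+1) r) + k' + k).
  by apply: ExecWhileStep ck' wk; rewrite regS.
by rewrite regS // [in leqRHS]mulSn leq_add // leq_add // bK.
Qed.

Definition add_coins (s : state) (z : seq bool) : state :=
  State (reg s) (memory s) (coins s ++ z).

(** Coins are consumed from the front, so a surplus at the end passes through every run
    untouched. *)
Lemma exec_add_coins c s s' k z :
  exec c s s' k -> exec c (add_coins s z) (add_coins s' z) k.
Proof.
elim=> {c s s' k}.
- by move=> s; apply: ExecSkip.
- by move=> *; apply: ExecConst.
- by move=> *; apply: ExecArith.
- by move=> *; apply: ExecRead.
- by move=> *; apply: ExecWrite.
- by move=> *; apply: ExecFlip.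
- by move=> c d s1 s2 s3 k l _ IHc _ IHd; apply: ExecSeq IHc IHd.
- by move=> r c d s s' k rs _ IH; apply: (@ExecIfTrue r c d (add_coins s z)).
- by move=> r c d s s' k rs _ IH; apply: (@ExecIfFalse r c d (add_coins s z)).
- by move=> r c s rs; apply: (@ExecWhileStop r c (add_coins s z)).
- move=> r c s1 s2 s3 k l rs _ IHc _ IHw.
  exact: (@ExecWhileStep r c (add_coins s1 z) _ _ _ _ rs IHc IHw).
Qed.

(** * Reductions between problems *)

Lemma size_take_tuple (T e : nat) (A : Type) (w : (T + e).-tuple A) :
  size (take T w) == T.
Proof. by rewrite size_takel // size_tuple leq_addr. Qed.

Lemma size_drop_tuple (T e : nat) (A : Type) (w : (T + e).-tuple A) :
  size (drop T w) == e.
Proof. by rewrite size_drop size_tuple addKn. Qed.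

(** Concatenation is a bijection from pairs of words, and the last [e] letters are free. *)
Lemma card_set_take (T e : nat) (A : finType) (p : pred (T.-tuple A)) :
  #|[set w : (T + e).-tuple A | p (Tuple (size_take_tuple w))]%SET|
    = #|[set w | p w]%SET| * #|A| ^ e.
Proof.
pose cat (u : T.-tuple A * e.-tuple A) := [tuple of u.1 ++ u.2].
have takeK u : Tuple (size_take_tuple (cat u)) = u.1.
  by apply: val_inj => /=; rewrite take_size_cat // size_tuple.
have dropK u : Tuple (size_drop_tuple (cat u)) = u.2.
  by apply: val_inj => /=; rewrite drop_size_cat // size_tuple.
have catI : injective cat.
  by move=> u u' E; rewrite [u]surjective_pairing [u']surjective_pairing
     -!takeK -!dropK E.
have -> : #|A| ^ e = #|[set: e.-tuple A]%SET| by rewrite cardsT card_tuple.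
rewrite -cardsX -(card_imset _ catI); congr #|pred_of_set _|.
apply/setP=> w; rewrite inE; apply/idP/imsetP => [pw|[u + ->]].
  exists (Tuple (size_take_tuple w), Tuple (size_drop_tuple w)).
    by rewrite !inE andbT.
  by apply: val_inj; rewrite /= cat_take_drop.
by rewrite takeK !inE andbT.
Qed.

(** The program [c] flips no coins and hands all [T + k] of them to [d], whose answer is read off
    from the first [T]. *)
Lemma decides_within_seq (R : realType) c d x y T k b :
  (forall w, exists2 j, exec c (init x w) (init y w) j & j <= k) ->
  decides_within R d y T b -> decides_within R (Seq c d) x (T + k) b.
Proof.
move=> cxy [out [ans err]].
exists (fun w => out (Tuple (size_take_tuple w))); split=> [w|].
  have [s [l [ds lT sb]]] := ans (Tuple (size_take_tuple w)).
  have [j cj jk] := cxy w.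
  exists (add_coins s (drop T w)), (j + l); split=> //; last first.
    by rewrite addnC leq_add.
  apply: ExecSeq cj _; have := exec_add_coins (drop T w) ds.
  by rewrite /add_coins /init /= cat_take_drop.
(* The surplus coins multiply the bad outcomes and the sample space by the same factor [2 ^ k]. *)
rewrite (card_set_take k (fun w => out w != b)) card_tuple expnD.
rewrite card_tuple in err; rewrite !natrM invfM mulrACA.
by rewrite divff ?mulr1 // pnatr_eq0 card_bool expn_eq0.
Qed.

Lemma leq_horner (q : {poly nat}) (x y : nat) :
  x <= y -> (q.[x])%R <= (q.[y])%R.
Proof.
move=> xy; elim/poly_ind: q => [|q a IH]; first by rewrite !horner0.
by rewrite !hornerMXaddC !natrDE !natrME leq_add2r leq_mul.
Qed.

(** Raising the parameter by at most [e] costs a constant factor [2 ^ (eps * e)], which the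
    polynomial absorbs. Since [c] ends in a genuine initial state, the algorithm for [Q] can simply
    follow it. *)
Lemma solvable_reduction (R : realType) (P Q : problem) (p : P -> nat)
    (q : Q -> nat) (f : P -> Q) (c : cmd) (r : {poly nat}) (e : nat) (eps : R) :
  (0 <= eps)%R ->
  (forall I, yes (f I) = yes I) ->
  (forall I, q (f I) <= p I + e) ->
  (forall I, input_size (f I) <= (r.[input_size I])%R) ->
  (forall I w, exists2 k, exec c (init (encode I) w) (init (encode (f I)) w) k
     & k <= (r.[input_size I])%R) ->
  solvable_with_exponent q eps -> solvable_with_exponent p eps.
Proof.
move=> eps0 yesE qp size_f cf [d [s Hs]].
have pw x : (0 <= 2%:R `^ x :> R)%R by exact: powR_ge0.
(* Polynomials have natural coefficients here, so the real factor is rounded up to [C]. *)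
have [C powC] : exists C : nat, (2%:R `^ (eps * e%:R) <= C%:R :> R)%R.
  by exists (Num.bound (2%:R `^ (eps * e%:R) : R)%R); rewrite ltW ?archi_boundP.
exists (Seq c d), (C%:P * (s \Po r) + r)%R => I.
have [T [TE dT]] := Hs (f I).
exists (T + (r.[input_size I])%R); split; last first.
  by rewrite -yesE; apply: decides_within_seq dT => w; apply: cf.
rewrite hornerD hornerM hornerC horner_comp natrDE natrME.
set m := input_size I; rewrite !natrD natrM mulrDr lerD //; last first.
  (* The exponential factor is at least 1, so multiplying the cost of the reduction by it only
     weakens the bound. *)
  rewrite ler_peMl // -[leLHS](powRr0 2%:R) ler_powR // ?mulr_ge0 //.
  by rewrite ler1n.
apply: (le_trans TE).
rewrite mulrA ler_pM //; last first.
  by rewrite ler_nat leq_horner.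
apply: (@le_trans _ _ (2%:R `^ (eps * (p I)%:R) * 2%:R `^ (eps * e%:R))%R).
  rewrite -powRD ?pnatr_eq0 ?implybT // -mulrDr -natrD ler_powR ?ler1n //.
  by rewrite ler_wpM2l // ler_nat.
by rewrite ler_wpM2l.
Qed.

Lemma le_sigma (R : realType) (P Q : problem) (p : P -> nat) (q : Q -> nat) :
  (forall eps : R, (0 < eps)%R ->
    solvable_with_exponent q eps -> solvable_with_exponent p eps) ->
  (sigma R P p <= sigma R Q q)%E.
Proof.
move=> pq; apply: ereal_inf_le_tmp => _ [eps [eps0 qe] <-].
by exists eps => //; split=> //; apply: pq.
Qed.

(** * The Steiner tree instance *)

(** Membership extended by false to all numbers, so that elements, vertices and addresses share one
    type. *)
Definition member n (A : {set 'I_n}) (i : nat) : bool :=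
  if insub i is Some o then o \in A else false.

Lemma member_ord n (A : {set 'I_n}) (i : 'I_n) : member A i = (i \in A).
Proof. by rewrite /member valK. Qed.

Lemma member_ge n (A : {set 'I_n}) i : n <= i -> member A i = false.
Proof. by move=> ni; rewrite /member insubF // ltnNge ni. Qed.

Lemma size_char_vector n (A : {set 'I_n}) : size (char_vector A) = n.
Proof. by rewrite size_map size_enum_ord. Qed.

Lemma nth_char_vector n (A : {set 'I_n}) i :
  nth 0 (char_vector A) i = member A i.
Proof.
have [ni|ni] := leqP n i.
  by rewrite member_ge // nth_default ?size_char_vector.
rewrite -[i]/(val (Ordinal ni)) member_ord.
by rewrite (nth_map (Ordinal ni)) ?size_enum_ord // nth_ord_enum.
Qed.

Lemma size_flatten_uniform (T : Type) w (ss : seq (seq T)) :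
  all (fun s => size s == w) ss -> size (flatten ss) = size ss * w.
Proof.
by elim: ss => //= s ss IH /andP[/eqP sw /IH]; rewrite size_cat sw => ->.
Qed.

Lemma nth_flatten_uniform (T : Type) (x0 : T) w (ss : seq (seq T)) j i :
  all (fun s => size s == w) ss -> i < w ->
  nth x0 (flatten ss) (j * w + i) = nth x0 (nth [::] ss j) i.
Proof.
elim: ss j => [|s ss IH] j; first by rewrite !nth_nil.
case: j => [|j] /=; first by case/andP=> /eqP sw _ iw; rewrite nth_cat sw iw.
case/andP=> /eqP sw ssw iw.
by rewrite nth_cat sw mulSn -addnA ltnNge leq_addr addKn IH.
Qed.

Lemma all_size_char_vector (T : Type) n (F : T -> {set 'I_n}) s :
  all (fun u => size u == n) [seq char_vector (F x) | x <- s].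
Proof. by elim: s => //= x s ->; rewrite size_char_vector eqxx. Qed.

Lemma size_st_encode J : size (st_encode J) = (st_v J + st_v J * st_v J).+2.
Proof.
rewrite /st_encode /= size_cat size_char_vector.
rewrite (size_flatten_uniform (all_size_char_vector _ _)).
by rewrite size_map size_enum_ord.
Qed.

Lemma nth_st_encode_term J y : y < st_v J ->
  nth 0 (st_encode J) y.+2 = member (st_term J) y.
Proof.
by move=> yv; rewrite /st_encode /= nth_cat size_char_vector yv nth_char_vector.
Qed.

(** The terminal vector has the length of a row and counts as row 0, which shifts the row of [x] to
    [x + 1]; the header adds 2. *)
Lemma nth_st_encode_adj J (x y : 'I_(st_v J)) :
  nth 0 (st_encode J) (x.+1 * st_v J + y).+2 = st_adj x y.
Proof.
rewrite /st_encode /= nth_cat size_char_vector mulSn -addnA.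
rewrite ltnNge leq_addr addKn /=.
rewrite nth_flatten_uniform ?all_size_char_vector //.
rewrite (nth_map x) ?size_enum_ord // nth_ord_enum nth_char_vector.
by rewrite member_ord inE.
Qed.

Section Reduction.
Variables (k : nat) (I : set_cover_instance k).

Local Notation n := (sc_n I).
Local Notation L := (sc_list I).

Lemma size_sc_encode : size (sc_encode I) = 3 + n + size L * n.
Proof.
rewrite /sc_encode /= size_cat size_char_vector.
by rewrite (size_flatten_uniform (all_size_char_vector id _)) size_map.
Qed.

Lemma nth_sc_encode j i : i < n ->
  nth 0 (sc_encode I) (j * n + i + n + 3) = member (nth finset.set0 L j) i.
Proof.
move=> i_n; rewrite addnC /sc_encode /= nth_cat size_char_vector.
rewrite ltnNge leq_addl add0n addnK /=.
rewrite nth_flatten_uniform ?(all_size_char_vector id) //.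
have [jL|Lj] := ltnP j (size L).
  by rewrite (nth_map finset.set0) // nth_char_vector.
(* Past the last set the memory reads 0, in agreement with the default set, which is empty. *)
rewrite [nth [::] _ _]nth_default ?size_map // nth_nil nth_default //.
by rewrite -[i]/(val (Ordinal i_n)) member_ord inE.
Qed.

(** This bounds the number of sets by the input size. If [n] is 0, sets occupy no cells, but a list
    without repetitions has at most one entry. *)
Lemma size_sc_list_le : size L <= (size L * n).+1.
Proof.
have [n0|] := posnP n; last by move=> n0; rewrite leqW // leq_pmulr.
have : size L <= #|{set 'I_n}| by rewrite -(card_uniqP (sc_uniq I)) max_card.
rewrite (_ : #|{set 'I_n}| = 1) => [/leq_trans|]; first exact.
by rewrite -cardsT -powersetT card_powerset cardsT card_ord n0.
Qed.

(* The element [i] of the universe is the vertex [i], the set at position [j] of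
   the list is the vertex [n + 1 + j], and [n] is an extra vertex adjacent to
   all the sets.  Placing the sets last makes row [n + 1 + j] of the adjacency
   matrix lie beyond the characteristic vector of set [j] in the input, so that
   the matrix can be written over the input, from its end to its beginning. *)
Definition cover_edge (x y : nat) : bool :=
  (n < x) && ((y == n) || member (nth finset.set0 L (x - n.+1)) y).

Definition cover_adj (x y : nat) : bool := cover_edge x y || cover_edge y x.

Lemma cover_adj_sym : symmetric cover_adj.
Proof. by move=> x y; rewrite /cover_adj orbC. Qed.

Lemma cover_adj_irr : irreflexive cover_adj.
Proof.
move=> x; rewrite /cover_adj orbb /cover_edge; case: ltnP => //= nx.
by rewrite gtn_eqF //= member_ge // ltnW.
Qed.

Definition cover_graph : steiner_instance :=
  @SteinerInstance (n + size L).+1 (fun x y => cover_adj x y)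
    (fun x y => cover_adj_sym x y) (fun x => cover_adj_irr x)
    [set x | val x <= n]%SET (n + sc_t I).+1.

Local Notation J := cover_graph.
Local Notation v := (n + size L).+1.

Lemma nth_cover_graph x y : x <= v -> y < v ->
  nth 0 (st_encode J) (x * v + y).+2
    = if x is x'.+1 then cover_adj x' y else y <= n.
Proof.
case: x => [_ yv|x xv yv].
  rewrite mul0n nth_st_encode_term //.
  by rewrite -[y in LHS]/(val (Ordinal yv)) member_ord inE.
exact: (@nth_st_encode_adj J (Ordinal xv) (Ordinal yv)).
Qed.

End Reduction.

(** * A program for the reduction *)

Definition block : seq cmd -> cmd := foldr Seq Skip.

(* Registers: 1, 2, 3 and 4 hold n, the number v of vertices, the bound on the
   Steiner tree, and the number of cells behind the header. *)
Definition setup : cmd := block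
  [:: Const 1 1; Read 2 1; Const 3 2; Read 3 3; Const 4 1; Read 1 0;
      Arith Add 2 1 2; Arith Add 2 2 4; Arith Add 3 1 3; Arith Add 3 3 4;
      Arith Mul 4 2 2; Arith Add 4 4 2].

(* With e := (register 4) - 1 = x * v + y, this computes x, y, y - n and
   (y <= n) in registers 6 to 9. *)
Definition locate : cmd := block
  [:: Const 5 1; Arith Defs.Sub 4 4 5; Arith Div 6 4 2; Arith Mul 7 6 2;
      Arith Defs.Sub 7 4 7; Arith Defs.Sub 8 7 1; Arith Defs.Sub 9 5 8].

(* Row 0 describes the terminals, row x + 1 the neighbours of x. *)
Definition lookup : cmd :=
  If 6
    (block [:: Arith Defs.Sub 6 6 5; Arith Defs.Sub 10 6 1;
      If 10
        (block [:: Arith Defs.Sub 11 1 7;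
           If 11
             (block [:: Arith Defs.Sub 10 10 5; Arith Mul 10 10 1;
                Arith Add 10 10 7; Arith Add 10 10 1; Const 11 3;
                Arith Add 10 10 11; Read 9 10])
             Skip])
        (If 8
           (block [:: Arith Mul 10 7 2; Arith Add 10 10 6; Arith Add 10 10 2;
              Const 11 2; Arith Add 10 10 11; Read 9 10])
           (Const 9 0))])
    Skip.

(** Clearing the scratch registers makes the state between rounds depend on the counter alone. *)
Definition store : cmd := block
  [:: Const 5 2; Arith Add 5 4 5; Write 5 9; Const 5 0; Const 6 0; Const 7 0;
      Const 8 0; Const 9 0; Const 10 0; Const 11 0].

(** The counter in register 4 is 0 after the loop, so it serves as the address of the first header
    cell. *)
Definition finish : cmd := block
  [:: Write 4 2; Const 1 1; Write 1 3; Const 1 0; Const 2 0; Const 3 0].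

Definition reduce : cmd :=
  Seq setup (Seq (While 4 (Seq locate (Seq lookup store))) finish).

(** Registers are kept as a finite list padded with 0, so that symbolic execution proceeds by
    computation. *)
Lemma eta_nth s r x :
  [eta nth 0 s with r |-> x] = nth 0 (set_nth 0 s r x) :> (nat -> nat).
Proof. by apply: funext => i; rewrite nth_set_nth. Qed.

Section Run.
Variables (s : seq nat) (h : nat -> nat) (w : seq bool).

Lemma run_const r x :
  run (Const r x) (State (nth 0 s) h w) = State (nth 0 (set_nth 0 s r x)) h w.
Proof. by rewrite -eta_nth. Qed.

Lemma run_arith o r a b : run (Arith o r a b) (State (nth 0 s) h w)
  = State (nth 0 (set_nth 0 s r (arith_val o (nth 0 s a) (nth 0 s b)))) h w.
Proof. by rewrite -eta_nth. Qed.

Lemma run_read r a : run (Read r a) (State (nth 0 s) h w)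
  = State (nth 0 (set_nth 0 s r (h (nth 0 s a)))) h w.
Proof. by rewrite -eta_nth. Qed.

Lemma run_write a b : run (Write a b) (State (nth 0 s) h w)
  = State (nth 0 s) [eta h with nth 0 s a |-> nth 0 s b] w.
Proof. by []. Qed.

Lemma run_if r c d : run (If r c d) (State (nth 0 s) h w)
  = if nth 0 s r != 0 then run c (State (nth 0 s) h w)
    else run d (State (nth 0 s) h w).
Proof. by []. Qed.

End Run.

Lemma run_seq c d s : run (Seq c d) s = run d (run c s).
Proof. by []. Qed.

Lemma run_skip s : run Skip s = s.
Proof. by []. Qed.

Arguments run : simpl never.
(* Keeps the kernel from evaluating whole programs at [Qed]. *)
Strategy opaque [run].

Definition runE :=
  (run_seq, run_skip, run_const, run_arith, run_read, run_write).

Section Program.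
Variables (k : nat) (I : set_cover_instance k).

Local Notation n := (sc_n I).
Local Notation L := (sc_list I).
Local Notation J := (cover_graph I).
Local Notation v := (n + size L).+1.

(** Writing goes downwards: from cell [b + 2] on the output is final, below it the input is
    intact. *)
Definition loop_memory (b a : nat) : nat :=
  if a < b.+2 then nth 0 (sc_encode I) a else nth 0 (st_encode J) a.

Definition loop_state (w : seq bool) (b : nat) : state :=
  State (nth 0 [:: 0; n; v; (n + sc_t I).+1; b]) (loop_memory b) w.

Lemma run_setup w : run setup (init (sc_encode I) w) = loop_state w (v * v + v).
Proof.
rewrite /init (_ : (fun=> 0) = nth 0 [::]); last first.
  by apply: funext => i; rewrite nth_nil.
do !rewrite runE /=; rewrite !addn1.
congr State; apply: funext => i; rewrite /loop_memory.
case: ifP => // /negbT; rewrite -leqNgt => le_i.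
(* The output is at least as long as the input, so beyond its end both encodings read 0. *)
rewrite !nth_default //; last by rewrite size_sc_encode; nia.
by rewrite size_st_encode addnC.
Qed.

Lemma run_finish w : run finish (loop_state w 0) = init (st_encode J) w.
Proof.
rewrite /loop_state; do !rewrite runE /=.
congr State; apply: funext => i; last by case: i => [|[|i]].
by do 5?[case: i => [|i]]; rewrite //= nth_nil.
Qed.

Lemma loop_memoryS e :
  loop_memory e = [eta loop_memory e.+1 with e.+2 |-> nth 0 (st_encode J) e.+2].
Proof.
apply: funext => a /=; rewrite /loop_memory [a < e.+3]ltnS (leq_eqVlt a).
by case: (eqVneq a e.+2) => //= ->; rewrite ltnn.
Qed.

Lemma run_locate w e :
  run locate (loop_state w e.+1) =
  State (nth 0 [:: 0; n; v; (n + sc_t I).+1; e; 1; e %/ v; e %% v; e %% v - n;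
                   1 - (e %% v - n)]) (loop_memory e.+1) w.
Proof.
have modE : e - e %/ v * v = e %% v by rewrite {1}(divn_eq e v) addKn.
rewrite /loop_state; do !rewrite runE /=.
by rewrite subn1 /= modE.
Qed.

(** Rows of sets are computed from input not yet overwritten. Rows of elements and of the extra
    vertex are copied, by symmetry, from rows of sets already written. *)
Lemma run_body w e : e < v * v + v ->
  run (Seq locate (Seq lookup store)) (loop_state w e.+1) = loop_state w e.
Proof.
move=> eB; rewrite run_seq run_locate.
have vP : 0 < v by [].
have yv : e %% v < v by rewrite ltn_pmod.
have xv : e %/ v <= v by rewrite -ltnS ltn_divLR //; nia.
have := nth_cover_graph xv yv; rewrite -divn_eq.
move: (divn_eq e v) xv yv; move: (e %/ v) (e %% v) => x y eE xv yv.
(* Cleared registers agree with absent ones, the default of [nth] being 0. *)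
have leave m :
    State (nth 0 [:: 0; n; v; (n + sc_t I).+1; e; 0; 0; 0; 0; 0; 0; 0])
    [eta loop_memory e.+1 with e + 2 |-> m] w
  = State (nth 0 [:: 0; n; v; (n + sc_t I).+1; e])
    [eta loop_memory e.+1 with e.+2 |-> m] w.
  rewrite addn2; congr State; apply: funext => i.
  by do 12?[case: i => [|i]] => //=; rewrite nth_nil.
rewrite /loop_state (loop_memoryS e) => ->.
rewrite run_seq /lookup run_if /=.
have yn_n : 1 - (y - n) = (y <= n) by case: leqP => ?; lia.
case: x eE xv => [|x] eE xv /=.
  by do !rewrite runE /=; rewrite leave yn_n.
do !rewrite runE /=; rewrite run_if /= subn1 /= subn_eq0 -ltnNge.
case: (ltnP n x) => [nx|xn] /=.
  do !rewrite runE /=; rewrite run_if /= subn_eq0 -ltnNge.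
  case: (ltnP y n) => [y_n|ny] /=; do !rewrite runE /=; rewrite leave.
    (* This address is at most [e + 2], so the cell still holds the input. *)
    have -> : loop_memory e.+1 ((x - n - 1) * n + y + n + 3) =
        nth 0 (sc_encode I) ((x - n - 1) * n + y + n + 3).
      by rewrite /loop_memory ifT // eE; nia.
    rewrite nth_sc_encode // /cover_adj /cover_edge nx ltn_eqF //=.
    by rewrite ltnNge (ltnW y_n) //= orbF subn1 -subnS.
  (* Nothing is read: register 9 still holds [y <= n], which for [n <= y] singles out the extra
     vertex. *)
  rewrite yn_n /cover_adj /cover_edge nx /= member_ge // orbF.
  rewrite (gtn_eqF nx) (@member_ge _ _ x) ?(ltnW nx) // andbF orbF.
  by rewrite eqn_leq ny andbT.
rewrite run_if /= subn_eq0 -ltnNge; case: (ltnP n y) => [ny|yn] /=.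
  do !rewrite runE /=; rewrite leave.
  (* The row of [y] comes after that of [x], so it is already written. *)
  have -> : loop_memory e.+1 (y * v + x + v + 2) =
      nth 0 (st_encode J) (y.+1 * v + x).+2.
    rewrite /loop_memory ifF; last by rewrite eE; nia.
    by congr nth; rewrite mulSn; lia.
  by rewrite nth_cover_graph // cover_adj_sym.
do !rewrite runE /=; rewrite leave.
by rewrite /cover_adj /cover_edge !ltnNge xn yn.
Qed.

(** * Bit lengths and running time of the reduction *)

Lemma bounded_init x w l :
  (\sum_(y <- x) bitlen y).+1 <= l -> bounded l (init x w).
Proof.
move=> xl; split=> i /=; last exact: leq_trans (bitlen_nth _ _) xl.
by rewrite /bitlen trunc_log0 (leq_trans _ xl).
Qed.

Lemma bounded_loop_state w b : b <= v * v + v ->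
  bounded (\sum_(x <- sc_encode I) bitlen x
             + \sum_(x <- st_encode J) bitlen x).+1
    (loop_state w b).
Proof.
move=> bB; have := size_le_sum_bitlen (st_encode J); rewrite size_st_encode.
set m := \sum_(x <- sc_encode I) _; set m' := \sum_(x <- st_encode J) _.
rewrite [st_v _]/= => Bm'.
have small x : x < m' -> bitlen x <= (m + m').+1.
  by move=> xm; apply: leq_trans (bitlen_leS _) _; lia.
split=> i /=; last first.
  rewrite /loop_memory; case: ifP => _.
    by apply: leq_trans (bitlen_nth _ _) _; rewrite ltnS leq_addr.
  by apply: leq_trans (bitlen_nth _ _) _; rewrite ltnS leq_addl.
(* Registers are smaller than the length of the output, except for [n + t + 1], which may be huge
   but is itself a word of the output. *)
case: i => [|[|[|[|[|i]]]]] /=; rewrite ?nth_nil; try by apply: small; nia.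
by apply: leq_trans (bitlen_nth (st_encode J) 1) _; rewrite ltnS leq_addl.
Qed.

Lemma sum_bitlen_char_vector p (A : {set 'I_p}) :
  \sum_(x <- char_vector A) bitlen x = p.
Proof.
rewrite big_map -[RHS]size_enum_ord -sum1_size; apply: eq_bigr => i _.
by case: (i \in A).
Qed.

Lemma sum_bitlen_char_vectors p (T : Type) (F : T -> {set 'I_p}) s :
  \sum_(x <- flatten [seq char_vector (F y) | y <- s]) bitlen x = size s * p.
Proof.
elim: s => [|y s IH] /=; first by rewrite big_nil.
by rewrite big_cat /= sum_bitlen_char_vector IH.
Qed.

Lemma input_size_cover_graph (m := input_size (I : set_cover k)) :
  input_size (J : steiner_tree) <= (m + 2) ^ 2.
Proof.
have -> : input_size (J : steiner_tree)
    = bitlen v + (bitlen (n + sc_t I).+1 + (v + v * v)).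
  rewrite /input_size /= /st_encode !big_cons big_cat /= sum_bitlen_char_vector.
  by rewrite sum_bitlen_char_vectors size_enum_ord.
have mE : m =
    bitlen n + (bitlen (size L) + (bitlen (sc_t I) + (n + size L * n))).
  rewrite /m /input_size /= /sc_encode !big_cons big_cat /=.
  by rewrite sum_bitlen_char_vector (sum_bitlen_char_vectors id).
have Lm := size_sc_list_le I; have n0 : 0 < bitlen n by [].
have L0 : 0 < bitlen (size L) by [].
(* The input size sees only the bit length of [t], so the new bound is estimated by bit lengths, not
   values. *)
have tm := bitlen_arith Add n.+1 (sc_t I); rewrite /= addSn in tm.
have [vS nS] := (bitlen_leS v, bitlen_leS n.+1).
have vm : v <= m by lia.
have tm2 : bitlen (n + sc_t I).+1 <= 2 * m by lia.
have := leq_mul vm vm; rewrite -mulnn.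
move: (bitlen _) (bitlen _) vS tm2 vm => bv bt {mE Lm tm}.
move: v m => u m *; rewrite mulnDl mulnDr; lia.
Qed.

End Program.

(** Here [l] bounds both the number of rounds and, up to a constant, the cost of each. The total is
    of order [l ^ 2], with [l] at most [(m + 3) ^ 2]. *)
Lemma exec_reduce : exists D, forall k (I : set_cover_instance k) w,
  exists2 j,
    exec reduce (init (sc_encode I) w) (init (st_encode (cover_graph I)) w) j
    & j <= D * (input_size (I : set_cover k) + 3) ^ 4.
Proof.
have [D1 H1] := @exec_straight setup isT.
have [D2 H2] := @exec_straight (Seq locate (Seq lookup store)) isT.
have [D3 H3] := @exec_straight finish isT.
exists (D1 + 2 * D2.+1 + D3) => k I w.
have := input_size_cover_graph I; have := @bounded_loop_state _ I w.
have := size_le_sum_bitlen (st_encode (cover_graph I)); rewrite size_st_encode.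
have := @bounded_init (sc_encode I) w _
  (leq_addr (input_size (cover_graph I : steiner_tree)) _).
rewrite [st_v _]/= /input_size /= -/(input_size (I : set_cover k)).
rewrite /input_size /=.
set v := (sc_n I + _).+1; set m := \sum_(x <- _) _; set m' := \sum_(x <- _) _.
set l := (m + m').+1; rewrite addSn -/l => b_init Bm' b_loop m'm.
have Bl : (v * v + v).+1 <= l.
  by rewrite addnC /l ltnS (leq_trans (ltnW (ltnW Bm'))) ?leq_addl.
have [j1 [e1 j1l _]] := H1 _ _ b_init; rewrite run_setup -/v in e1.
(* The successor of [D2] lets the same bound cover the test of the counter, of cost at most [l]. *)
have [||b bB|j2 e2 j2l] := @exec_countdown (loop_state I w) 4
  (Seq locate (Seq lookup store)) (D2.+1 * l) (v * v + v).
- by [].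
- move=> b bB; apply: (@leq_trans l); last exact: leq_pmull.
  by apply: leq_trans (bitlen_leS _) (leq_trans _ Bl).
- have [j [ej jl _]] := H2 _ _ (b_loop _ bB); rewrite run_body // in ej.
  by exists j => //; apply: leq_trans jl _; rewrite leq_mul2r leqnSn orbT.
have [j3 [e3 j3l _]] := H3 _ _ (b_loop 0 isT); rewrite run_finish in e3.
exists (j1 + (j2 + j3)); first exact: ExecSeq e1 (ExecSeq e2 e3).
have ll : l <= l ^ 2 by rewrite -mulnn leq_pmulr.
have lm : l <= (m + 3) ^ 2.
  by rewrite /l; move: m'm; rewrite -!mulnn !mulnDl !mulnDr; lia.
apply: (@leq_trans ((D1 + 2 * D2.+1 + D3) * l ^ 2)); last first.
  by rewrite leq_mul2l (expnM _ 2 2) leq_exp2r // lm orbT.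
rewrite !mulnDl -addnA leq_add ?(leq_trans j1l) ?leq_mul2l ?ll ?orbT //.
rewrite leq_add ?(leq_trans j3l) ?leq_mul2l ?ll ?orbT //.
apply: (leq_trans j2l); rewrite -mulnn.
apply: leq_trans (leq_mul Bl (leqnn _)) _; apply: eq_leq; ring.
Qed.

(** * Set covers and Steiner trees *)

Section Solutions.
Variables (k : nat) (I : set_cover_instance k).

Local Notation n := (sc_n I).
Local Notation L := (sc_list I).
Local Notation J := (cover_graph I).
Local Notation v := (n + size L).+1.

(** Outside the list the index is too large and [inord] returns a dummy vertex, whence the
    conditions [A \in L] below. *)
Definition set_vertex (A : {set 'I_n}) : 'I_v := inord (n.+1 + index A L).

Definition cover_tree (C : {set {set 'I_n}}) : {set 'I_v} :=
  ([set x : 'I_v | x <= n] :|: [set set_vertex A | A in C])%SET.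

Lemma val_set_vertex A : A \in L -> set_vertex A = n.+1 + index A L :> nat.
Proof. by move=> AL; rewrite inordK // addSn ltnS ltn_add2l index_mem. Qed.

Lemma set_vertexK A : A \in L -> nth finset.set0 L (set_vertex A - n.+1) = A.
Proof. by move=> AL; rewrite val_set_vertex // addKn nth_index. Qed.

Lemma lt_set_vertex A : A \in L -> n < set_vertex A.
Proof. by move=> AL; rewrite val_set_vertex // leq_addr. Qed.

Lemma nth_vertexK (x : 'I_v) : n < x ->
  set_vertex (nth finset.set0 L (x - n.+1)) = x.
Proof.
move=> nx; have xL : x - n.+1 < size L by have := ltn_ord x; lia.
apply: val_inj; rewrite /= val_set_vertex ?mem_nth //.
by rewrite index_uniq ?sc_uniq // subnKC.
Qed.

Lemma cover_adj_elem x y : x < n ->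
  cover_adj I x y = (n < y) && member (nth finset.set0 L (y - n.+1)) x.
Proof.
by move=> xn; rewrite /cover_adj /cover_edge ltnNge (ltnW xn) (ltn_eqF xn).
Qed.

Section Subfamily.
Variable C : {set {set 'I_n}}.
Hypothesis CL : C \subset sc_family I.

Let in_list A : A \in C -> A \in L.
Proof. by move=> /(fintype.subsetP CL); rewrite inE. Qed.

Lemma mem_cover_tree (x : 'I_v) : (x \in cover_tree C)
  = (x <= n) || (nth finset.set0 L (x - n.+1) \in C).
Proof.
rewrite !inE; have [//|nx] := leqP x n.
apply/imsetP/idP => [[A A_C ->]|xC]; first by rewrite set_vertexK ?in_list.
by exists (nth finset.set0 L (x - n.+1)); rewrite ?nth_vertexK.
Qed.

Lemma set_vertex_tree A : A \in L ->
  (set_vertex A \in cover_tree C) = (A \in C).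
Proof.
by move=> AL; rewrite mem_cover_tree set_vertexK // leqNgt lt_set_vertex.
Qed.

(** Distinct sets have distinct vertices, all beyond the terminals. The parity version relies on
    this exact count. *)
Lemma card_cover_tree : #|cover_tree C| = n.+1 + #|C|.
Proof.
rewrite /cover_tree cardsU (_ : _ :&: _ = finset.set0)%SET; last first.
  apply/setP=> x; rewrite !inE; apply/negP => /andP[xn /imsetP[A A_C xA]].
  by move: xn; rewrite xA leqNgt lt_set_vertex ?in_list.
rewrite cards0 subn0 card_in_imset => [|A B A_C BC AB]; last first.
  by rewrite -[A]set_vertexK ?in_list // AB set_vertexK ?in_list.
congr addn; rewrite -sum1dep_card.
rewrite (eq_bigl (fun x : 'I_v => x < n.+1)) //.
by rewrite -(big_ord_widen v (fun=> 1)) ?ltnS ?leq_addr // sum1_card card_ord.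
Qed.

Lemma cover_tree_solution :
  steiner_solution J (cover_tree C) = (\bigcup_(A in C) A == [set: 'I_n])%SET.
Proof.
pose rt : 'I_v := inord n.
have rtE : rt = n :> nat by rewrite inordK // ltnS leq_addr.
have rt_in : rt \in cover_tree C by rewrite mem_cover_tree rtE leqnn.
rewrite /steiner_solution finset.subsetUl /=; apply/idP/eqP => [conn|cov].
  apply/setP => i; rewrite inE; pose x : 'I_v := inord i.
  have i_n := ltn_ord i.
  have xE : x = i :> nat by rewrite inordK // ltnS ltnW // ltn_addr.
  have x_in : x \in cover_tree C by rewrite mem_cover_tree xE ltnW.
  (* A path from an element to the extra vertex is not empty, and its first edge leads to a chosen
     set containing the element. *)
  have /connectP[[/= _ /(congr1 val)/=|y p /= /andP[/and3P[_ yC xy] _] _]] :=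
    forall_inP (forall_inP conn x x_in) rt rt_in.
    by rewrite rtE xE => /eqP; rewrite gtn_eqF.
  move: xy yC; rewrite cover_adj_elem ?xE // mem_cover_tree => /andP[ny].
  rewrite member_ord leqNgt ny /= => iA A_C; apply/bigcupP.
  by exists (nth finset.set0 L (y - n.+1)).
pose e := fun a b : 'I_v =>
  [&& a \in cover_tree C, b \in cover_tree C & cover_adj I a b].
have e_sym : connect_sym e.
  by apply: sym_connect_sym => a b; rewrite /e andbCA cover_adj_sym.
have set_rt A : A \in C -> connect e rt (set_vertex A).
  move=> A_C; apply: connect1.
  rewrite /e rt_in set_vertex_tree ?in_list // A_C /= cover_adj_sym.
  by rewrite /cover_adj /cover_edge lt_set_vertex ?in_list // rtE eqxx.
(* The extra vertex is a hub: chosen sets are adjacent to it, and covered elements reach it through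
   a chosen set. *)
suff to_rt x : x \in cover_tree C -> connect e rt x.
  apply/forall_inP => x xC; apply/forall_inP => y yC.
  by apply: connect_trans (to_rt y yC); rewrite e_sym to_rt.
move=> xC; have [xn|nx|xn] := ltngtP x n; last 2 first.
- rewrite -(nth_vertexK nx) set_rt //.
  by move: xC; rewrite mem_cover_tree leqNgt nx.
- by rewrite (_ : x = rt) //; apply: val_inj; rewrite /= rtE.
pose i := Ordinal xn; have : i \in (\bigcup_(A in C) A)%SET by rewrite cov inE.
case/bigcupP => A A_C iA; apply: connect_trans (set_rt A A_C) _.
rewrite e_sym; apply: connect1.
rewrite /e xC set_vertex_tree ?in_list // A_C /=.
rewrite cover_adj_elem // lt_set_vertex ?in_list // set_vertexK ?in_list //.
by rewrite -[x : nat]/(val i) member_ord.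
Qed.

End Subfamily.

(** A solution contains all terminals, so only its set vertices are free, and they spell out [C]. *)
Lemma solution_cover_tree (X : {set 'I_v}) : steiner_solution J X ->
  exists2 C : {set {set 'I_n}}, C \subset sc_family I & X = cover_tree C.
Proof.
case/andP=> /= /fintype.subsetP TX _.
pose C := [set A in sc_family I | set_vertex A \in X]%SET.
have CL : C \subset sc_family I.
  by apply/fintype.subsetP => A; rewrite inE => /andP[].
exists C => //; apply/setP => x; rewrite mem_cover_tree //.
have [xn|nx] := leqP x n; first by rewrite TX ?inE.
have xL : x - n.+1 < size L by have := ltn_ord x; lia.
by rewrite !inE mem_nth // nth_vertexK.
Qed.

Lemma cover_tree_inj : {in [set C | covers I C]%SET &, injective cover_tree}.
Proof.
move=> C D; rewrite !inE => /andP[CL _] /andP[DL _] CD; apply/setP => A.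
have [AL|AL] := boolP (A \in L).
  by rewrite -(set_vertex_tree CL) // CD set_vertex_tree.
by apply/idP/idP => [/(fintype.subsetP CL)|/(fintype.subsetP DL)];
  rewrite inE (negPf AL).
Qed.

Lemma steiner_solutions :
  [set X | steiner_solution J X]%SET
    = [set cover_tree C | C in [set C | covers I C]%SET]%SET.
Proof.
apply/setP => X; rewrite inE; apply/idP/imsetP => [XS|[C + ->]].
  have [C CL XC] := solution_cover_tree XS; exists C => //.
  by rewrite inE /covers CL -cover_tree_solution // -XC.
by rewrite inE => /andP[CL cov]; rewrite cover_tree_solution.
Qed.

Lemma yes_steiner_tree : @yes steiner_tree J = @yes (set_cover k) I.
Proof.
apply/existsP/existsP => /= [[X /andP[XS Xt]]|[C /andP[covC Ct]]].
  have : X \in [set X | steiner_solution J X]%SET by rewrite inE.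
  rewrite steiner_solutions => /imsetP[C]; rewrite inE => covC XC; exists C.
  rewrite covC; move: Xt; rewrite XC card_cover_tree; last by case/andP: covC.
  by rewrite addSn ltnS leq_add2l.
have [CL cov] := andP covC; exists (cover_tree C).
by rewrite cover_tree_solution // cov card_cover_tree // addSn ltnS leq_add2l.
Qed.

(** [cover_tree] is injective on covers and adds exactly [n + 1] to the size, so the two counts are
    equal. *)
Lemma yes_parity_steiner_tree :
  @yes parity_steiner_tree J = @yes (parity_set_cover k) I.
Proof.
rewrite /=; congr odd.
rewrite -(card_in_imset (f := cover_tree)); last first.
  move=> C D; rewrite !inE => /andP[covC _] /andP[covD _].
  by apply: cover_tree_inj; rewrite inE.
congr #|pred_of_set _|; apply/setP => X; rewrite inE.
apply/andP/imsetP => [[XS Xt]|[C + ->]].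
  have : X \in [set X | steiner_solution J X]%SET by rewrite inE.
  rewrite steiner_solutions => /imsetP[C]; rewrite inE => covC XC.
  exists C => //; rewrite inE covC; move: Xt; rewrite XC card_cover_tree.
    by rewrite addSn eqSS eqn_add2l.
  by case/andP: covC.
rewrite inE => /andP[/andP[CL cov] Ct].
by rewrite cover_tree_solution // cov card_cover_tree // addSn eqSS eqn_add2l.
Qed.

End Solutions.

(** * Exponents *)

(** The answers [f] and [g] are left abstract to serve the decision and the parity version at
    once. *)
Lemma solvable_set_cover (R : realType) (k : nat) (eps : R)
    (f : forall k, set_cover_instance k -> bool)
    (g : steiner_instance -> bool) :
  (0 < eps)%R -> (forall I : set_cover_instance k, g (cover_graph I) = f k I) ->
  @solvable_with_exponent R (Problem st_encode g) st_t eps ->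
  @solvable_with_exponent R (Problem (@sc_encode k) (f k)) (@sc_param k) eps.
Proof.
move=> eps0 gf; have [D exec_D] := exec_reduce.
(* The first summand bounds the running time, the second the size of the graph. *)
pose r : {poly nat} := (D%:P * ('X + 3%:P) ^+ 4 + ('X + 2%:P) ^+ 2)%R.
have rE m : (r.[m])%R = D * (m + 3) ^ 4 + (m + 2) ^ 2.
  rewrite /r hornerD hornerM !horner_exp !hornerD !hornerC !hornerX.
  by rewrite !natrXE.
apply: (@solvable_reduction R (Problem (@sc_encode k) (f k))
  (Problem st_encode g) (@sc_param k) st_t (@cover_graph k) reduce r 1).
- exact: ltW.
- exact: gf.
- by move=> I; rewrite /= /sc_param addn1.
- move=> I; rewrite rE.
  exact: leq_trans (input_size_cover_graph I) (leq_addl _ _).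
- move=> I w; have [j ej jD] := exec_D k I w; exists j => //.
  by rewrite rE; apply: leq_trans jD (leq_addr _ _).
Qed.

Definition relax_instance (k l : nat) (kl : k <= l) (I : set_cover_instance k) :
    set_cover_instance l :=
  SetCoverInstance (sc_t I) (sc_uniq I) (fun A AI => leq_trans (sc_size AI) kl).

(** The encoding does not mention [k], so [Skip] is a reduction. *)
Lemma sigma_set_cover_le (R : realType) (k l : nat)
    (f : forall k, set_cover_instance k -> bool) :
  (forall k l (kl : k <= l) I, f l (relax_instance kl I) = f k I) -> k <= l ->
  (sigma R (Problem (@sc_encode k) (f k)) (@sc_param k)
    <= sigma R (Problem (@sc_encode l) (f l)) (@sc_param l))%E.
Proof.
move=> f_relax kl; apply: le_sigma => eps eps0.
apply: (@solvable_reduction R (Problem (@sc_encode k) (f k))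
  (Problem (@sc_encode l) (f l)) (@sc_param k) (@sc_param l)
  (relax_instance kl) Skip ('X + 1)%R 0).
- exact: ltW.
- exact: f_relax.
- by move=> I; rewrite addn0.
- by move=> I; rewrite hornerD hornerX hornerC leq_addr.
- move=> I w; exists 1; first exact: ExecSkip.
  by rewrite hornerD hornerC leq_addl.
Qed.

(** The exponents are nondecreasing in [k], so they converge in the extended reals, and a bound
    valid for every [k] passes to the limit. *)
Lemma lim_sigma_set_cover (R : realType)
    (f : forall k, set_cover_instance k -> bool) (g : steiner_instance -> bool)
    (u := fun k => sigma R (Problem (@sc_encode k) (f k)) (@sc_param k)) :
  (forall k l (kl : k <= l) I, f l (relax_instance kl I) = f k I) ->
  (forall k (I : set_cover_instance k), g (cover_graph I) = f k I) ->
  cvgn u /\ (limn u <= sigma R (Problem st_encode g) st_t)%E.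
Proof.
move=> f_relax gf.
have u_cvg : cvgn u.
  by apply: ereal_nondecreasing_is_cvgn => k l; apply: sigma_set_cover_le.
split=> //; apply: lime_le => //; apply: nearW => k.
by apply: le_sigma => eps eps0; apply: solvable_set_cover.
Qed.

Theorem theorem20 (R : realType) :
  (cvgn (fun k : nat => sigma R (set_cover k) (@sc_param k)) /\
   (limn (fun k : nat => sigma R (set_cover k) (@sc_param k))
      <= sigma R steiner_tree st_t)%E) /\
  (cvgn (fun k : nat => sigma R (parity_set_cover k) (@sc_param k)) /\
   (limn (fun k : nat => sigma R (parity_set_cover k) (@sc_param k))
      <= sigma R parity_steiner_tree st_t)%E).
Proof.
split.
- apply: (@lim_sigma_set_cover R (fun k => @yes (set_cover k))
            (@yes steiner_tree)) => //.
  exact: yes_steiner_tree.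
- apply: (@lim_sigma_set_cover R (fun k => @yes (parity_set_cover k))
            (@yes parity_steiner_tree)) => //.
  exact: yes_parity_steiner_tree.
Qed.
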